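(* Let $\alpha(x)\in\mathcal L$ be a first-order formula with one free variable $x$, over the signature with no constants, one binary predicate symbol $R$ and one unary predicate symbol for each $P\in\mathrm{Prop}$. Then $\alpha(x)$ is logically equivalent to the standard translation $\mathrm{st}(x,\psi)$ of some modal formula $\psi\in\mathcal L_{\Box\Diamond}$ if and only if $\alpha(x)$ is invariant under IK-bisimulations.
   Context: **First-order language.** Fix a denumerable set $\mathrm{Prop}$ of propositional letters and a denumerable set $\mathrm{Var}$ of variables. The signature has no constants and no function symbols; its predicate symbols are $\mathrm{Pred}=\mathrm{Prop}\cup\{R\}$, each $P\in\mathrm{Prop}$ being unary and $R$ binary. $\mathcal L$ is generated by $\varphi::=P(x)\mid R(x,y)\mid\bot\mid\varphi\wedge\varphi\mid\varphi\vee\varphi\mid\varphi\to\varphi\mid\forall x\,\varphi\mid\exists x\,\varphi$ with $x,y\in\mathrm{Var}$, $P\in\mathrm{Prop}$ (no equality). **Intuitionistic structures.** An intuitionistic structure is $\mathfrak M=(W,\le,\{\mathfrak C_w\}_{w\in W})$ where $(W,\le)$ is a poset and each $\mathfrak C_w=(D_w,I_w)$ is a classical structure, i.e. $D_w$ is a nonempty set, $I_w(P)\subseteq D_w$ for $P\in\mathrm{Prop}$ and $I_w(R)\subseteq D_w^2$, such that $w\le w'$ implies $D_w\subseteq D_{w'}$ and $I_w(Q)\subseteq I_{w'}(Q)$ for every predicate symbol $Q$. Put $D_{\mathfrak M}=\bigcup_{w\in W}D_w$. An assignment for $\mathfrak M$ is any map $\rho:\mathrm{Var}\to D_{\mathfrak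 M}$; $\rho[x:=d]$ is the assignment sending $x$ to $d$ and agreeing with $\rho$ elsewhere. Satisfaction $\mathfrak M,w\Vdash^\rho\varphi$ is defined as follows: for an atom $Q(x_1,\dots,x_n)$, iff $(\rho(x_1),\dots,\rho(x_n))\in I_w(Q)$; $\bot$ never; $\varphi\wedge\psi$ iff $\mathfrak M,w\Vdash^\rho\varphi$ and $\mathfrak M,w\Vdash^\rho\psi$; $\varphi\vee\psi$ iff $\mathfrak M,w\Vdash^\rho\varphi$ or $\mathfrak M,w\Vdash^\rho\psi$; $\varphi\to\psi$ iff for all $w'\ge w$, $\mathfrak M,w'\Vdash^\rho\varphi$ implies $\mathfrak M,w'\Vdash^\rho\psi$; $\forall x\,\varphi$ iff for all $w'\ge w$ and all $d\in D_{w'}$, $\mathfrak M,w'\Vdash^{\rho[x:=d]}\varphi$; $\exists x\,\varphi$ iff there is $d\in D_w$ with $\mathfrak M,w\Vdash^{\rho[x:=d]}\varphi$. For a formula with only $x$ free, $\mathfrak M,w\Vdash^{[x:=d]}\varphi$ means $\mathfrak M,w\Vdash^\rho\varphi$ for an arbitrary assignment $\rho$ with $\rho(x)=d$. **Consequence and logical equivalence.** For $\Gamma,\Delta\subseteq\mathcal L$, $\Delta$ is a consequence of $\Gamma$, written $\Gamma\models\Delta$, if for every intuitionistic structure $\mathfrak M=(W,\le,\{\mathfrak C_w\}_{w\in W})$ there are no world $w\in W$ and assignment $\rho:\mathrm{Var}\to D_{\mathfrak M}$ such that $\mathfrak M,w\Vdash^\rho\gamma$ for all $\gamma\in\Gamma$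 and $\mathfrak M,w\not\Vdash^\rho\delta$ for all $\delta\in\Delta$. Formulas $\varphi,\psi\in\mathcal L$ are logically equivalent if $\{\varphi\}\models\{\psi\}$ and $\{\psi\}\models\{\varphi\}$; that is, for every intuitionistic structure $\mathfrak M$, every world $w$ and every assignment $\rho:\mathrm{Var}\to D_{\mathfrak M}$, $\mathfrak M,w\Vdash^\rho\varphi$ iff $\mathfrak M,w\Vdash^\rho\psi$. **Modal language and standard translation.** $\mathcal L_{\Box\Diamond}$ is generated by $\varphi::=P\mid\bot\mid\varphi\wedge\varphi\mid\varphi\vee\varphi\mid\varphi\to\varphi\mid\Box\varphi\mid\Diamond\varphi$, $P\in\mathrm{Prop}$. The standard translation is: $\mathrm{st}(x,P)=P(x)$, $\mathrm{st}(x,\bot)=\bot$, $\mathrm{st}(x,\varphi\star\psi)=\mathrm{st}(x,\varphi)\star\mathrm{st}(x,\psi)$ for $\star\in\{\wedge,\vee,\to\}$, $\mathrm{st}(x,\Box\varphi)=\forall y(R(x,y)\to\mathrm{st}(y,\varphi))$, $\mathrm{st}(x,\Diamond\varphi)=\exists y(R(x,y)\wedge\mathrm{st}(y,\varphi))$, with $y$ fresh. **Birelational models.** A birelational model is $\mathfrak B=(W,\le,R,V)$ with $(W,\le)$ a poset, $V$ mapping each $P\in\mathrm{Prop}$ to an upset of $(W,\le)$, and $R\subseteq W\times W$ such that: if $w\le v$ and $wRu$ then there is $t$ with $vRt$ and $u\le t$; and if $wRu$ and $u\le v$ then there is $t$ with $w\le t$ and $tRv$. The birelational model $\mathfrak B_{\mathfrak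 M}=(W^\bullet,\le^\bullet,R^\bullet,V^\bullet)$ induced by an intuitionistic structure $\mathfrak M$ is given by $W^\bullet=\{(w,d)\mid w\in W,\ d\in D_w\}$; $(w,d)\le^\bullet(w',d')$ iff $w\le w'$ and $d=d'$; $(w,d)R^\bullet(w',d')$ iff $w=w'$ and $(d,d')\in I_w(R)$; $V^\bullet(P)=\{(w,d)\mid d\in I_w(P)\}$. **IK-bisimulations.** Write $w\,(\le;R)\,v$ if there is $t$ with $w\le t$ and $tRv$. An IK-bisimulation between birelational models $\mathfrak B=(W,\le,R,V)$ and $\mathfrak B'=(W',\le',R',V')$ is a relation $Z\subseteq W\times W'$ such that for all $(w,w')\in Z$: (i) $w\in V(p)$ iff $w'\in V'(p)$ for all $p\in\mathrm{Prop}$; (ii) if $w\le v$ there is $v'$ with $(v,v')\in Z$ and $w'\le'v'$; (iii) if $w'\le'v'$ there is $v$ with $(v,v')\in Z$ and $w\le v$; (iv) if $wRv$ there is $v'$ with $(v,v')\in Z$ and $w'(\le';R')v'$; (v) if $w'R'v'$ there is $v$ with $(v,v')\in Z$ and $w(\le;R)v$; (vi) if $wRv$ there are $s\in W$, $s'\in W'$ with $v\le s$, $w'R's'$ and $(s,s')\in Z$; (vii) if $w'R'v'$ there are $s'\in W'$, $s\in W$ with $v'\le's'$, $wRs$ and $(s,s')\in Z$. **Invariance.** A formula $\varphi(x)\in\mathcal L$ with one free variable $x$ is invariant under IK-bisimulations if for all intuitionistic structures $\mathfrak M=(W,\le,\{\mathfrak C_w\}_{w\in W})$ and $\mathfrak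 M'=(W',\le',\{\mathfrak C_{w'}\}_{w'\in W'})$, worlds $w\in W$ and $w'\in W'$, and individuals $d\in D_w$, $d'\in D_{w'}$: if some IK-bisimulation between $\mathfrak B_{\mathfrak M}$ and $\mathfrak B_{\mathfrak M'}$ links $(w,d)$ and $(w',d')$, then $\mathfrak M,w\Vdash^{[x:=d]}\varphi(x)$ iff $\mathfrak M',w'\Vdash^{[x:=d']}\varphi(x)$.
   Formalization: Logical equivalence is taken over assignments with values in D_w, the domain of the world of evaluation, instead of D_M; with values in D_M the claim fails: ∃y(P(y)→P(x)) is invariant under IK-bisimulations but equivalent to no standard translation. *)

(* Defs.v *)
From Stdlib Require Import Arith Relations Ensembles ProofIrrelevance.

(** * First-order language *)

(* Both denumerable sets are represented by [nat]. *)
Definition letter := nat.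
Definition var := nat.

Inductive form : Type :=
| FPred (P : letter) (x : var)
| FRel (x y : var)
| FBot
| FAnd (f g : form)
| FOr (f g : form)
| FImp (f g : form)
| FAll (x : var) (f : form)
| FEx (x : var) (f : form).

Fixpoint free_in (z : var) (f : form) : Prop :=
  match f with
  | FPred _ x => z = x
  | FRel x y => z = x \/ z = y
  | FBot => False
  | FAnd f g | FOr f g | FImp f g => free_in z f \/ free_in z g
  | FAll x f | FEx x f => z <> x /\ free_in z f
  end.

(* "[f] has one free variable [x]": no variable other than [x] is free. *)
Definition only_free (x : var) (f : form) : Prop :=
  forall z, free_in z f -> z = x.

(** * Intuitionistic structures *)

(* [ind] is the union of all the domains (this is [dom_cover]), so that an
   assignment into that union is exactly a map [var -> ind]. *)
Record structure : Type := Structure {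
  world : Type;
  ind : Type;
  wle : relation world;
  dom : world -> ind -> Prop;
  ipred : world -> letter -> ind -> Prop;
  irel : world -> ind -> ind -> Prop;
  wle_order : order world wle;
  dom_inhabited : forall w, exists d, dom w d;
  dom_cover : forall d, exists w, dom w d;
  ipred_dom : forall w P d, ipred w P d -> dom w d;
  irel_dom : forall w d e, irel w d e -> dom w d /\ dom w e;
  dom_mono : forall w w' d, wle w w' -> dom w d -> dom w' d;
  ipred_mono : forall w w' P d, wle w w' -> ipred w P d -> ipred w' P d;
  irel_mono : forall w w' d e, wle w w' -> irel w d e -> irel w' d e
}.

Arguments wle {s} _ _.
Arguments dom {s} _ _.
Arguments ipred {s} _ _ _.
Arguments irel {s} _ _ _.

Definition assignment (M : structure) : Type := var -> ind M.

Definition update {M : structure} (rho : assignment M) (x : var) (d : ind M)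
  : assignment M :=
  fun z => if Nat.eqb z x then d else rho z.

Fixpoint sat (M : structure) (w : world M) (rho : assignment M) (f : form)
  : Prop :=
  match f with
  | FPred P x => ipred w P (rho x)
  | FRel x y => irel w (rho x) (rho y)
  | FBot => False
  | FAnd f g => sat M w rho f /\ sat M w rho g
  | FOr f g => sat M w rho f \/ sat M w rho g
  | FImp f g => forall w', wle w w' -> sat M w' rho f -> sat M w' rho g
  | FAll x f =>
      forall w', wle w w' -> forall d, dom w' d -> sat M w' (update rho x d) f
  | FEx x f => exists d, dom w d /\ sat M w (update rho x d) f
  end.

(* Satisfaction of a formula whose only free variable is [x], at [x := d]. *)
Definition sat_at (M : structure) (w : world M) (x : var) (d : ind M)
  (f : form) : Prop :=
  forall rho : assignment M, rho x = d -> sat M w rho f.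

(** * Consequence and logical equivalence *)

(* The values of the assignment lie in the domain of the world of evaluation.
   If [rho] could take values outside [dom w], then the formula
   [exists y, P y -> P x], which holds at every [w] and [d] with [dom w d] and
   so is invariant under IK-bisimulations, would not be equivalent to any
   standard translation: it fails at [w] when [dom w] is a singleton [{e}],
   [P e] holds, and the value of [x] enters the domain only later, whereas a
   standard translation that holds whenever the value of [x] is in the domain
   also holds there. *)
Definition consequence (Gamma Delta : Ensemble form) : Prop :=
  forall (M : structure) (w : world M) (rho : assignment M),
    (forall z, dom w (rho z)) ->
    ~ ((forall f, In form Gamma f -> sat M w rho f) /\
       (forall f, In form Delta f -> ~ sat M w rho f)).

Definition logically_equivalent (f g : form) : Prop :=
  consequence (Singleton form f) (Singleton form g) /\
  consequence (Singleton form g) (Singleton form f).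

(** * Modal language and standard translation *)

Inductive modal : Type :=
| MLetter (P : letter)
| MBot
| MAnd (f g : modal)
| MOr (f g : modal)
| MImp (f g : modal)
| MBox (f : modal)
| MDia (f : modal).

(* [st y f] has no free variable besides [y], so any [y <> x], such as [S x],
   is fresh. *)
Fixpoint st (x : var) (f : modal) : form :=
  match f with
  | MLetter P => FPred P x
  | MBot => FBot
  | MAnd f g => FAnd (st x f) (st x g)
  | MOr f g => FOr (st x f) (st x g)
  | MImp f g => FImp (st x f) (st x g)
  | MBox f => FAll (S x) (FImp (FRel x (S x)) (st (S x) f))
  | MDia f => FEx (S x) (FAnd (FRel x (S x)) (st (S x) f))
  end.

(** * Birelational models *)

Record birel_model : Type := BirelModel {
  bworld : Type;
  ble : relation bworld;
  brel : relation bworld;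
  bval : letter -> bworld -> Prop;
  ble_order : order bworld ble;
  bval_upset : forall P w v, ble w v -> bval P w -> bval P v;
  brel_forth : forall w v u,
    ble w v -> brel w u -> exists t, brel v t /\ ble u t;
  brel_back : forall w u v,
    brel w u -> ble u v -> exists t, ble w t /\ brel t v
}.

Arguments ble {b} _ _.
Arguments brel {b} _ _.
Arguments bval {b} _ _.

Record point (M : structure) : Type := Point {
  pt_world : world M;
  pt_ind : ind M;
  pt_dom : dom pt_world pt_ind
}.

Arguments Point {M} _ _ _.
Arguments pt_world {M} _.
Arguments pt_ind {M} _.
Arguments pt_dom {M} _.

Definition pt_le {M : structure} (p q : point M) : Prop :=
  wle (pt_world p) (pt_world q) /\ pt_ind p = pt_ind q.

Definition pt_rel {M : structure} (p q : point M) : Prop :=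
  pt_world p = pt_world q /\ irel (pt_world p) (pt_ind p) (pt_ind q).

Definition pt_val {M : structure} (P : letter) (p : point M) : Prop :=
  ipred (pt_world p) P (pt_ind p).

Lemma pt_le_order (M : structure) : order (point M) pt_le.
Proof.
destruct (wle_order M) as [r t a]; split.
- intros p; split; [apply r | reflexivity].
- intros p q s [H1 H2] [H3 H4]; split; [eapply t; eassumption | congruence].
- intros [w d h] [w' d' h'] [H1 H2] [H3 _]; simpl in *.
  assert (w = w') by (apply a; assumption); subst.
  f_equal; apply proof_irrelevance.
Qed.

Lemma pt_val_upset (M : structure) P (p q : point M) :
  pt_le p q -> pt_val P p -> pt_val P q.
Proof.
intros [H1 H2] H; unfold pt_val in *; rewrite <- H2.
eapply ipred_mono; eassumption.
Qed.

Lemma pt_rel_forth (M : structure) (p q r : point M) :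
  pt_le p q -> pt_rel p r -> exists t, pt_rel q t /\ pt_le r t.
Proof.
destruct p as [w d hw], q as [v d' hv], r as [u e hu].
intros [H1 H2] [H3 H4]; simpl in *; subst.
exists (Point v e (dom_mono M _ _ _ H1 hu)); repeat split; simpl; auto.
eapply irel_mono; eassumption.
Qed.

Lemma pt_rel_back (M : structure) (p r q : point M) :
  pt_rel p r -> pt_le r q -> exists t, pt_le p t /\ pt_rel t q.
Proof.
destruct p as [w d hw], q as [v d' hv], r as [u e hu].
intros [H1 H2] [H3 H4]; simpl in *; subst.
exists (Point v d (dom_mono M _ _ _ H3 hw)); repeat split; simpl; auto.
eapply irel_mono; eassumption.
Qed.

Definition induced (M : structure) : birel_model :=
  BirelModel (point M) pt_le pt_rel pt_val (pt_le_order M) (pt_val_upset M)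
    (pt_rel_forth M) (pt_rel_back M).

(** * IK-bisimulations *)

Definition ble_brel {B : birel_model} (w v : bworld B) : Prop :=
  exists t, ble w t /\ brel t v.

Record IK_bisimulation (B B' : birel_model)
  (Z : bworld B -> bworld B' -> Prop) : Prop := {
  bisim_val : forall w w', Z w w' -> forall P, bval P w <-> bval P w';
  bisim_le_forth : forall w w', Z w w' ->
    forall v, ble w v -> exists v', Z v v' /\ ble w' v';
  bisim_le_back : forall w w', Z w w' ->
    forall v', ble w' v' -> exists v, Z v v' /\ ble w v;
  bisim_box_forth : forall w w', Z w w' ->
    forall v, brel w v -> exists v', Z v v' /\ ble_brel w' v';
  bisim_box_back : forall w w', Z w w' ->
    forall v', brel w' v' -> exists v, Z v v' /\ ble_brel w v;
  bisim_dia_forth : forall w w', Z w w' ->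
    forall v, brel w v -> exists s s', ble v s /\ brel w' s' /\ Z s s';
  bisim_dia_back : forall w w', Z w w' ->
    forall v', brel w' v' -> exists s' s, ble v' s' /\ brel w s /\ Z s s'
}.

(** * Invariance *)

Definition IK_invariant (x : var) (f : form) : Prop :=
  forall (M M' : structure) (w : world M) (w' : world M')
    (d : ind M) (d' : ind M') (Hd : dom w d) (Hd' : dom w' d')
    (Z : bworld (induced M) -> bworld (induced M') -> Prop),
    IK_bisimulation (induced M) (induced M') Z ->
    Z (Point w d Hd) (Point w' d' Hd') ->
    (sat_at M w x d f <-> sat_at M' w' x d' f).

(* Main.v *)
From Stdlib Require Import Arith List Lia Relations Ensembles.
From Stdlib Require Import Classical ClassicalEpsilon.
From mathcomp Require filter.
Require Import Defs.
Import ListNotations.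
Set Bullet Behavior "Strict Subproofs".

(** Standard translations are invariant because modal truth in the induced
    birelational model is preserved by IK-bisimulations, by induction on the
    modal formula.

    For the converse, suppose that [alpha] is invariant but equivalent to no
    modal formula.  For each finite set of modal consequences of [alpha] there
    is then a pointed structure that satisfies them and refutes [alpha].  An
    ultraproduct [M] of these structures, at a point [p], satisfies all modal
    consequences of [alpha] and still refutes [alpha].  No finite part of the
    theory of [p] (the formulas forced at [p] together with those not forced)
    is inconsistent with [alpha]: otherwise [alpha], being persistent, would
    entail an implication, from a conjunction of formulas forced at [p] to a
    disjunction of formulas not forced at [p], and this implication would be a
    modal consequence of [alpha] that fails at [p].  Hence a second
    ultraproduct has a point [q] that satisfies [alpha] and has the same modal
    theory as [p].

    Ultraproducts over a nonprincipal ultrafilter on [nat] satisfy the theorem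
    of Los ([los]) for intuitionistic satisfaction and realize every countable
    type that is finitely realized ([realize_countable_type]), which makes
    their induced models modally saturated ([ultraproduct_saturated]).  Between
    saturated models, having the same modal theory is an IK-bisimulation
    ([hennessy_milner]).  So [p] and [q] are bisimilar, although [alpha] holds
    at [q] only, which contradicts invariance. *)

(** * First-order satisfaction *)

Lemma update_eq (M : structure) (rho : assignment M) x d :
  update rho x d x = d.
Proof. unfold update; now rewrite Nat.eqb_refl. Qed.

Lemma update_neq (M : structure) (rho : assignment M) x d z :
  z <> x -> update rho x d z = rho z.
Proof. intros H; unfold update; apply Nat.eqb_neq in H; now rewrite H. Qed.

Lemma sat_free_ext (M : structure) f :
  forall w (rho rho' : assignment M),
    (forall z, free_in z f -> rho z = rho' z) ->
    (sat M w rho f <-> sat M w rho' f).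
Proof.
assert (Hupd : forall x g (rho rho' : assignment M) d,
  (forall z, z <> x /\ free_in z g -> rho z = rho' z) ->
  forall z, free_in z g -> update rho x d z = update rho' x d z).
{ intros x g rho rho' d H z Hz; unfold update.
  destruct (Nat.eqb_spec z x); auto. }
induction f; simpl; intros w rho rho' H.
- rewrite (H x eq_refl); tauto.
- rewrite (H x), (H y); tauto.
- tauto.
- rewrite (IHf1 w rho rho'), (IHf2 w rho rho') by auto; tauto.
- rewrite (IHf1 w rho rho'), (IHf2 w rho rho') by auto; tauto.
- split; intros HI w' Hw' H1;
    apply (IHf2 w' rho rho'); auto; apply HI; auto;
    apply (IHf1 w' rho rho'); auto.
- split; intros HI w' Hw' d Hd;
    apply (IHf w' _ _ (Hupd x f rho rho' d H)); auto.
- split; intros (d & Hd & HI); exists d; split; auto;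
    now apply (IHf w _ _ (Hupd x f rho rho' d H)).
Qed.

Lemma sat_persistent (M : structure) f :
  forall w w' rho, wle w w' -> sat M w rho f -> sat M w' rho f.
Proof.
destruct (wle_order M) as [_ Htr _].
induction f; simpl; intros w w' rho Hw.
- now apply ipred_mono.
- now apply irel_mono.
- auto.
- intros [H1 H2]; eauto.
- intros [H1|H2]; eauto.
- intros H w'' Hw'' H1; apply H; auto; eapply Htr; eauto.
- intros H w'' Hw'' d Hd; apply H; auto; eapply Htr; eauto.
- intros (d & Hd & H); exists d; split; eauto using dom_mono.
Qed.

Definition sat_pt {M : structure} (p : point M) (f : form) : Prop :=
  sat M (pt_world p) (fun _ => pt_ind p) f.

Lemma sat_pt_assignment (M : structure) (p : point M) x f rho :
  only_free x f -> rho x = pt_ind p ->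
  (sat M (pt_world p) rho f <-> sat_pt p f).
Proof.
intros Hf Hx; apply sat_free_ext; intros z Hz.
now rewrite (Hf z Hz).
Qed.

Lemma sat_at_sat_pt (M : structure) w x d (h : dom w d) f :
  only_free x f -> (sat_at M w x d f <-> sat_pt (Point w d h) f).
Proof.
intros Hf; split.
- intros H; now apply H.
- intros H rho Hr; now apply (sat_pt_assignment M (Point w d h) x f rho).
Qed.

(** * Modal forcing *)

Fixpoint force {B : birel_model} (p : bworld B) (f : modal) : Prop :=
  match f with
  | MLetter P => bval P p
  | MBot => False
  | MAnd f g => force p f /\ force p g
  | MOr f g => force p f \/ force p g
  | MImp f g => forall q, ble p q -> force q f -> force q g
  | MBox f => forall q, ble_brel p q -> force q f
  | MDia f => exists q, brel p q /\ force q f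
  end.

Lemma ble_refl (B : birel_model) (p : bworld B) : ble p p.
Proof. destruct (ble_order B) as [r _ _]; apply r. Qed.

Lemma ble_trans (B : birel_model) (p q r : bworld B) :
  ble p q -> ble q r -> ble p r.
Proof. destruct (ble_order B) as [_ t _]; apply t. Qed.

Lemma brel_ble_brel (B : birel_model) (p q : bworld B) :
  brel p q -> ble_brel p q.
Proof. intros H; exists p; split; auto using ble_refl. Qed.

Lemma ble_brel_ble (B : birel_model) (p q r : bworld B) :
  ble_brel p q -> ble q r -> ble_brel p r.
Proof.
intros (t & Ht & Hq) Hr.
destruct (brel_back B _ _ _ Hq Hr) as (t' & Ht' & Hr').
exists t'; split; auto; eapply ble_trans; eauto.
Qed.

Lemma force_persistent (B : birel_model) f :
  forall p q : bworld B, ble p q -> force p f -> force q f.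
Proof.
induction f; simpl; intros p q Hpq.
- now apply bval_upset.
- auto.
- intros [H1 H2]; eauto.
- intros [H1|H2]; eauto.
- intros H r Hr; apply H; eapply ble_trans; eauto.
- intros H r (t & Ht & Hr); apply H; exists t; split; auto.
  eapply ble_trans; eauto.
- intros (r & Hr & H).
  destruct (brel_forth B _ _ _ Hpq Hr) as (t & Ht & Hrt); eauto.
Qed.

(** The clauses of an IK-bisimulation match the inductive steps one for one:
    the [<=]-clauses serve implication, the [(<=;R)]-clauses serve box, and
    the weak diamond clauses suffice because forcing is persistent. *)
Lemma bisimulation_force (B B' : birel_model) Z :
  IK_bisimulation B B' Z ->
  forall f p p', Z p p' -> (force p f <-> force p' f).
Proof.
intros HZ; induction f; simpl; intros p p' Hp.
- now apply (bisim_val _ _ _ HZ).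
- tauto.
- rewrite (IHf1 _ _ Hp), (IHf2 _ _ Hp); tauto.
- rewrite (IHf1 _ _ Hp), (IHf2 _ _ Hp); tauto.
- split.
  + intros H q' Hq' H1.
    destruct (bisim_le_back _ _ _ HZ _ _ Hp _ Hq') as (q & Hq & Hle).
    apply (IHf2 _ _ Hq), H; auto; now apply (IHf1 _ _ Hq).
  + intros H q Hq H1.
    destruct (bisim_le_forth _ _ _ HZ _ _ Hp _ Hq) as (q' & Hq' & Hle).
    apply (IHf2 _ _ Hq'), H; auto; now apply (IHf1 _ _ Hq').
- split.
  + intros H q' (t' & Ht' & Hq').
    destruct (bisim_le_back _ _ _ HZ _ _ Hp _ Ht') as (t & Ht & Hle).
    destruct (bisim_box_back _ _ _ HZ _ _ Ht _ Hq') as (q & Hq & s & Hs & Hr).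
    apply (IHf _ _ Hq), H; exists s; split; auto; eapply ble_trans; eauto.
  + intros H q (t & Ht & Hq).
    destruct (bisim_le_forth _ _ _ HZ _ _ Hp _ Ht) as (t' & Ht' & Hle).
    destruct (bisim_box_forth _ _ _ HZ _ _ Ht' _ Hq)
      as (q' & Hq' & s & Hs & Hr).
    apply (IHf _ _ Hq'), H; exists s; split; auto; eapply ble_trans; eauto.
- split.
  + intros (q & Hq & H).
    destruct (bisim_dia_forth _ _ _ HZ _ _ Hp _ Hq) as (s & s' & Hs & Hs' & HZs).
    exists s'; split; auto; apply (IHf _ _ HZs); eapply force_persistent; eauto.
  + intros (q & Hq & H).
    destruct (bisim_dia_back _ _ _ HZ _ _ Hp _ Hq) as (s' & s & Hs' & Hs & HZs).
    exists s; split; auto; apply (IHf _ _ HZs); eapply force_persistent; eauto.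
Qed.

Lemma sat_st (M : structure) f :
  forall x (p : point M) (rho : assignment M), rho x = pt_ind p ->
    (sat M (pt_world p) rho (st x f) <-> force (B := induced M) p f).
Proof.
destruct (wle_order M) as [Hrefl Htr _].
induction f; simpl; intros x p rho Hx.
- unfold pt_val; rewrite Hx; tauto.
- tauto.
- rewrite (IHf1 x p rho Hx), (IHf2 x p rho Hx); tauto.
- rewrite (IHf1 x p rho Hx), (IHf2 x p rho Hx); tauto.
- split.
  + intros H q [Hw Hd] H1.
    apply (IHf2 x q rho); [congruence|]; apply H; auto.
    apply (IHf1 x q rho); [congruence|]; auto.
  + intros H w' Hw H1.
    pose (q := Point w' (pt_ind p) (dom_mono M _ _ _ Hw (pt_dom p))).
    apply (IHf2 x q rho); auto; apply H; [split; auto|].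
    apply (IHf1 x q rho); auto.
- split.
  + intros H q (t & [Hw Hd] & [Hw' Hr]).
    apply (IHf (S x) q (update rho (S x) (pt_ind q)) (update_eq _ _ _ _)).
    rewrite <- Hw'; apply (H (pt_world t) Hw).
    * rewrite Hw'; apply pt_dom.
    * apply Hrefl.
    * rewrite update_neq, update_eq, Hx, Hd; auto.
  + intros H w' Hw d Hd w'' Hw' Hr.
    rewrite update_neq, update_eq, Hx in Hr by auto.
    pose (q := Point w'' d (dom_mono M _ _ _ Hw' Hd)).
    apply (IHf (S x) q (update rho (S x) d) (update_eq _ _ _ _)), H.
    exists (Point w'' (pt_ind p) (proj1 (irel_dom M _ _ _ Hr))).
    split; split; simpl; auto; eapply Htr; eauto.
- split.
  + intros (d & Hd & Hr & H).
    rewrite update_neq, update_eq, Hx in Hr by auto.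
    pose (q := Point (pt_world p) d Hd).
    exists q; split; [split; auto|].
    apply (IHf (S x) q (update rho (S x) d) (update_eq _ _ _ _)), H.
  + intros (q & [Hw Hr] & H).
    exists (pt_ind q); split; [rewrite Hw; apply pt_dom|split].
    * rewrite update_neq, update_eq, Hx; auto.
    * rewrite Hw; apply (IHf (S x) q (update rho (S x) (pt_ind q)) (update_eq _ _ _ _)), H.
Qed.

Lemma logically_equivalent_st x alpha psi :
  only_free x alpha ->
  (logically_equivalent alpha (st x psi) <->
   forall (M : structure) (p : point M),
     sat_pt p alpha <-> force (B := induced M) p psi).
Proof.
intros Ha.
assert (Hc : forall f g, consequence (Singleton form f) (Singleton form g) <->
  forall (M : structure) w (rho : assignment M), (forall z, dom w (rho z)) ->
    sat M w rho f -> sat M w rho g).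
{ intros f g; split.
  - intros H M w rho Hr Hf; apply NNPP; intros Hg.
    apply (H M w rho Hr); split; intros h Hh; destruct Hh; auto.
  - intros H M w rho Hr [H1 H2].
    apply (H2 g (In_singleton _ _)), H; auto; apply H1, In_singleton. }
unfold logically_equivalent; rewrite !Hc; split.
- intros [H1 H2] M p.
  assert (Hd : forall z : var, dom (pt_world p) (pt_ind p))
    by (intros; apply pt_dom).
  rewrite <- (sat_st M psi x p (fun _ => pt_ind p) eq_refl).
  split; [apply H1 | apply H2]; auto.
- intros H; split; intros M w rho Hr;
    pose (p := Point w (rho x) (Hr x));
    pose proof (sat_st M psi x p rho eq_refl) as H1;
    pose proof (sat_pt_assignment M p x alpha rho Ha eq_refl) as H2;
    specialize (H M p); simpl pt_world in *; tauto.
Qed.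

(** * Finite fragments of the modal language *)

(** An increasing exhaustion of the modal language by finite lists, which is
    the form in which its countability is used. *)
Fixpoint stage (n : nat) : list modal :=
  match n with
  | 0 => [MBot]
  | S m =>
      MLetter m :: stage m ++ map MBox (stage m) ++ map MDia (stage m) ++
      flat_map (fun f => flat_map (fun g => [MAnd f g; MOr f g; MImp f g])
                           (stage m)) (stage m)
  end.

Lemma stage_mono m n f : m <= n -> List.In f (stage m) -> List.In f (stage n).
Proof.
induction 1; auto; intros Hf; simpl; right; apply in_or_app; auto.
Qed.

Lemma stage_exhaustive f : exists n, List.In f (stage n).
Proof.
assert (Hbin : forall f g m n, List.In f (stage m) -> List.In g (stage n) ->
  exists k, List.In (MAnd f g) (stage k) /\ List.In (MOr f g) (stage k) /\
    List.In (MImp f g) (stage k)).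
{ intros g h m n Hg Hh; exists (S (max m n)); simpl.
  assert (Hin : forall k, List.In k [MAnd g h; MOr g h; MImp g h] ->
    List.In k (flat_map (fun f => flat_map
      (fun g => [MAnd f g; MOr f g; MImp f g])
      (stage (max m n))) (stage (max m n)))).
  { intros k Hk; apply in_flat_map; exists g; split.
    - apply (stage_mono m); auto; lia.
    - apply in_flat_map; exists h; split; auto.
      apply (stage_mono n); auto; lia. }
  repeat split; right; do 3 (apply in_or_app; right); apply Hin; simpl; auto. }
induction f.
- exists (S P); simpl; auto.
- exists 0; simpl; auto.
- destruct IHf1 as [m Hm], IHf2 as [n Hn].
  destruct (Hbin _ _ _ _ Hm Hn) as [k Hk]; exists k; tauto.
- destruct IHf1 as [m Hm], IHf2 as [n Hn].
  destruct (Hbin _ _ _ _ Hm Hn) as [k Hk]; exists k; tauto.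
- destruct IHf1 as [m Hm], IHf2 as [n Hn].
  destruct (Hbin _ _ _ _ Hm Hn) as [k Hk]; exists k; tauto.
- destruct IHf as [m Hm]; exists (S m); simpl; right.
  apply in_or_app; right; apply in_or_app; left; now apply in_map.
- destruct IHf as [m Hm]; exists (S m); simpl; right.
  do 2 (apply in_or_app; right); apply in_or_app; left; now apply in_map.
Qed.

Lemma finite_conjunction (l : list modal) (T : modal -> Prop) :
  exists theta, forall B (p : bworld B),
    force p theta <-> forall f, List.In f l -> T f -> force p f.
Proof.
induction l as [|g l [theta IH]].
- exists (MImp MBot MBot); simpl; tauto.
- destruct (classic (T g)) as [Hg|Hg].
  + exists (MAnd g theta); intros B p; simpl; rewrite IH; split.
    * intros [H1 H2] f [<-|Hf]; auto.
    * intros H; split; auto.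
  + exists theta; intros B p; rewrite IH; split; simpl; intros H f Hf; auto.
    destruct Hf as [<-|Hf]; auto; tauto.
Qed.

Lemma finite_disjunction (l : list modal) (T : modal -> Prop) :
  exists chi, forall B (p : bworld B),
    force p chi <-> exists f, List.In f l /\ T f /\ force p f.
Proof.
induction l as [|g l [chi IH]].
- exists MBot; intros B p; simpl; split; [tauto|intros (f & [] & _)].
- destruct (classic (T g)) as [Hg|Hg].
  + exists (MOr g chi); intros B p; simpl; rewrite IH; split.
    * intros [H|(f & Hf & H)]; [exists g|exists f]; tauto.
    * intros (f & [<-|Hf] & H); [left; tauto|right; exists f; tauto].
  + exists chi; intros B p; rewrite IH; split; simpl.
    * intros (f & Hf & H); exists f; tauto.
    * intros (f & [<-|Hf] & H); [tauto|exists f; tauto].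
Qed.

Definition agrees_on {B : birel_model} (l : list modal) (T : modal -> Prop)
  (p : bworld B) : Prop :=
  forall f, List.In f l -> (force p f <-> T f).

(** Without negation, a finite piece of a theory, positive and negative parts
    together, is still controlled by one formula: the implication from its
    positive part to its negative part says that no point above realizes it. *)
Lemma excluding_formula (l : list modal) (T : modal -> Prop) :
  exists kappa, forall B (p : bworld B),
    force p kappa <-> forall q, ble p q -> ~ agrees_on l T q.
Proof.
destruct (finite_conjunction l T) as [theta Ht].
destruct (finite_disjunction l (fun f => ~ T f)) as [chi Hc].
exists (MImp theta chi); intros B p; simpl.
split; intros H q Hq.
- intros Ha.
  assert (Hchi : force q chi).
  { apply H; auto; apply Ht; intros f Hf HT; now apply Ha. }
  apply Hc in Hchi; destruct Hchi as (f & Hf & HnT & Hff).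
  now apply HnT, (Ha f Hf).
- rewrite Ht, Hc; intros Hpos; apply NNPP; intros Hneg.
  apply (H q Hq); intros f Hf; split; auto.
  intros Hff; apply NNPP; intros HnT; apply Hneg; eauto.
Qed.

Lemma excluding_formula_not_forced (l : list modal) (T : modal -> Prop) kappa :
  (forall B (p : bworld B),
    force p kappa <-> forall q, ble p q -> ~ agrees_on l T q) ->
  forall B (p : bworld B),
    ~ force p kappa <-> exists q, ble p q /\ agrees_on l T q.
Proof.
intros Hk B p; rewrite Hk; split.
- intros H; apply NNPP; intros H'; apply H; intros q Hq Ha; eauto.
- intros (q & Hq & Ha) H; exact (H q Hq Ha).
Qed.

(** * Saturated models *)

(** Theories above a point are prescribed completely, whereas only positive
    information is prescribed at [R]-successors: that is all that diamonds can
    express. *)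
Record saturated (B : birel_model) : Prop := {
  saturated_ble : forall (p : bworld B) (T : modal -> Prop),
    (forall n, exists q, ble p q /\ agrees_on (stage n) T q) ->
    exists q, ble p q /\ forall f, force q f <-> T f;
  saturated_ble_brel : forall (p : bworld B) (T : modal -> Prop),
    (forall n, exists q, ble_brel p q /\ agrees_on (stage n) T q) ->
    exists q, ble_brel p q /\ forall f, force q f <-> T f;
  saturated_brel : forall (p : bworld B) (T : modal -> Prop),
    (forall n, exists q, brel p q /\
       forall f, List.In f (stage n) -> T f -> force q f) ->
    exists q, brel p q /\ forall f, T f -> force q f
}.

Definition same_theory {B B' : birel_model} (p : bworld B) (p' : bworld B')
  : Prop :=
  forall f, force p f <-> force p' f.

Lemma same_theory_sym (B B' : birel_model) (p : bworld B) (p' : bworld B') :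
  same_theory p p' -> same_theory p' p.
Proof. intros H f; symmetry; apply H. Qed.

Lemma same_theory_ble (B B' : birel_model) (p v : bworld B) (p' : bworld B') :
  saturated B' -> same_theory p p' -> ble p v ->
  exists v', same_theory v v' /\ ble p' v'.
Proof.
intros HB' Hp Hv.
destruct (saturated_ble B' HB' p' (force v)) as (v' & Hv' & HT).
- intros n; destruct (excluding_formula (stage n) (force v)) as [kappa Hk].
  apply (excluding_formula_not_forced _ _ _ Hk).
  rewrite <- (Hp kappa); apply (excluding_formula_not_forced _ _ _ Hk).
  exists v; split; auto; intros f _; tauto.
- exists v'; split; auto; now apply same_theory_sym.
Qed.

Lemma same_theory_ble_brel (B B' : birel_model) (p v : bworld B)
  (p' : bworld B') :
  saturated B' -> same_theory p p' -> brel p v ->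
  exists v', same_theory v v' /\ ble_brel p' v'.
Proof.
intros HB' Hp Hv.
destruct (saturated_ble_brel B' HB' p' (force v)) as (v' & Hv' & HT).
- intros n; destruct (excluding_formula (stage n) (force v)) as [kappa Hk].
  assert (Hbox : ~ force p' (MBox kappa)).
  { rewrite <- (Hp (MBox kappa)); intros H.
    specialize (H v (brel_ble_brel _ _ _ Hv)); revert H.
    apply (excluding_formula_not_forced _ _ _ Hk).
    exists v; split; [apply ble_refl|intros f _; tauto]. }
  simpl in Hbox; apply not_all_ex_not in Hbox; destruct Hbox as [q Hq].
  apply imply_to_and in Hq; destruct Hq as [Hq Hnk].
  apply (excluding_formula_not_forced _ _ _ Hk) in Hnk.
  destruct Hnk as (r & Hr & Ha); exists r; split; auto.
  eapply ble_brel_ble; eauto.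
- exists v'; split; auto; now apply same_theory_sym.
Qed.

(** Diamonds provide an [R']-successor [s'] that forces all that [v] forces.
    It may force more, but then the theory of [s'] is consistent above [v]:
    a formula at [v] that excludes a finite part of this theory would also be
    forced at [s'], where that part is realized. *)
Lemma same_theory_brel (B B' : birel_model) (p v : bworld B) (p' : bworld B') :
  saturated B -> saturated B' -> same_theory p p' -> brel p v ->
  exists s s', ble v s /\ brel p' s' /\ same_theory s s'.
Proof.
intros HB HB' Hp Hv.
destruct (saturated_brel B' HB' p' (force v)) as (s' & Hs' & HT).
- intros n; destruct (finite_conjunction (stage n) (force v)) as [theta Ht].
  assert (Hdia : force p' (MDia theta)).
  { rewrite <- (Hp (MDia theta)); exists v; split; auto; apply Ht; auto. }
  destruct Hdia as (q & Hq & Hf); exists q; split; auto; now apply Ht.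
- destruct (saturated_ble B HB v (force s')) as (s & Hs & Hsame).
  + intros n; destruct (excluding_formula (stage n) (force s')) as [kappa Hk].
    apply (excluding_formula_not_forced _ _ _ Hk).
    intros H; apply HT in H; revert H.
    apply (excluding_formula_not_forced _ _ _ Hk).
    exists s'; split; [apply ble_refl|intros f _; tauto].
  + exists s, s'; auto.
Qed.

Lemma hennessy_milner (B B' : birel_model) :
  saturated B -> saturated B' -> IK_bisimulation B B' same_theory.
Proof.
intros HB HB'; split; intros p p' Hp.
- intros P; exact (Hp (MLetter P)).
- intros v Hv; now apply (same_theory_ble B B' p v p').
- intros v' Hv'; apply same_theory_sym in Hp.
  destruct (same_theory_ble B' B p' v' p HB Hp Hv') as (v & H1 & H2).
  exists v; split; auto; now apply same_theory_sym.
- intros v Hv; now apply (same_theory_ble_brel B B' p v p').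
- intros v' Hv'; apply same_theory_sym in Hp.
  destruct (same_theory_ble_brel B' B p' v' p HB Hp Hv') as (v & H1 & H2).
  exists v; split; auto; now apply same_theory_sym.
- intros v Hv; now apply (same_theory_brel B B' p v p').
- intros v' Hv'; apply same_theory_sym in Hp.
  destruct (same_theory_brel B' B p' v' p HB' HB Hp Hv')
    as (s' & s & H1 & H2 & H3).
  exists s', s; repeat split; auto; now apply same_theory_sym.
Qed.

(** * Ultrafilters on the natural numbers *)

(** [U A] reads: [A n] holds for almost all [n]. *)
Record nonprincipal_ultrafilter (U : (nat -> Prop) -> Prop) : Prop := {
  large_tail : forall m, U (fun n => m <= n);
  large_mono : forall A B : nat -> Prop, (forall n, A n -> B n) -> U A -> U B;
  large_and : forall A B : nat -> Prop, U A -> U B -> U (fun n => A n /\ B n);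
  large_not : forall A : nat -> Prop, U (fun n => ~ A n) <-> ~ U A
}.

Lemma nonprincipal_ultrafilter_exists : exists U, nonprincipal_ultrafilter U.
Proof.
destruct (filter.ultraFilterLemma (F := filter.eventually)
  filter.eventually_filter) as (U & HU & Hev).
pose proof (filter.ultra_proper (UltraFilter := HU)) as HP.
pose proof (filter.filter_filter (ProperFilter := HP)) as HF.
exists U; split.
- intros m; apply Hev; exists m; [exact I|].
  intros n Hn; simpl in *; now apply (Bool.reflect_iff _ _ ssrnat.leP).
- intros A B H; exact (filter.filterS (Filter := HF) H).
- intros A B; apply (filter.filterI (Filter := HF)).
- intros A; split.
  + intros H1 H2; apply (filter.filter_not_empty U (ProperFilter := HP)).
    apply (fun s => filter.filterS (Filter := HF) s (filter.filterI (Filter := HF) H1 H2)).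
    intros n [H H']; exact (H H').
  + intros H; destruct (filter.in_ultra_setVsetC A HU) as [H'|H'];
      [contradiction|exact H'].
Qed.

Lemma large_mono2 U (HU : nonprincipal_ultrafilter U) (A B C : nat -> Prop) :
  (forall n, A n -> B n -> C n) -> U A -> U B -> U C.
Proof.
intros H HA HB; apply (large_mono U HU (fun n => A n /\ B n)).
- intros n []; auto.
- now apply large_and.
Qed.

Lemma large_all U (HU : nonprincipal_ultrafilter U) (A : nat -> Prop) :
  (forall n, A n) -> U A.
Proof.
intros H; apply (large_mono U HU (fun n => 0 <= n)); auto.
now apply large_tail.
Qed.

Lemma large_or U (HU : nonprincipal_ultrafilter U) (A B : nat -> Prop) :
  U (fun n => A n \/ B n) <-> U A \/ U B.
Proof.
split.
- intros H; apply NNPP; intros H'; apply not_or_and in H'.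
  rewrite <- !(large_not U HU) in H'; destruct H' as [HA HB].
  refine (proj1 (large_not U HU _) _ H).
  revert HA HB; apply (large_mono2 U HU); tauto.
- intros [H|H]; revert H; apply large_mono; auto.
Qed.

Lemma large_iff_const U (HU : nonprincipal_ultrafilter U) (A : nat -> Prop)
  (P : Prop) :
  U (fun n => A n <-> P) <-> (U A <-> P).
Proof.
destruct (classic P) as [HP|HP]; split.
- intros H; split; auto; intros _; revert H; apply large_mono; tauto.
- intros H; apply H in HP as HA; revert HA; apply large_mono; tauto.
- intros H; split; [|contradiction]; intros HA; exfalso.
  refine (proj1 (large_not U HU A) _ HA); revert H; apply large_mono; tauto.
- intros H; assert (HA : ~ U A) by tauto.
  apply (large_not U HU) in HA; revert HA; apply large_mono; tauto.
Qed.

Lemma large_all_in U (HU : nonprincipal_ultrafilter U) (X : Type) (l : list X)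
  (A : X -> nat -> Prop) :
  (forall f, List.In f l -> U (A f)) ->
  U (fun n => forall f, List.In f l -> A f n).
Proof.
induction l as [|g l IH]; intros H.
- apply (large_all U HU); intros n f [].
- apply (large_mono2 U HU (A g) (fun n => forall f, List.In f l -> A f n)).
  + intros n Hg Hl f [<-|Hf]; auto.
  + apply H; simpl; auto.
  + apply IH; intros f Hf; apply H; simpl; auto.
Qed.

Lemma dependent_choice_function (X : nat -> Type) (P : forall n, X n -> Prop) :
  (forall n, exists x, P n x) -> exists x : forall n, X n, forall n, P n (x n).
Proof.
intros H.
exists (fun n => proj1_sig (constructive_indefinite_description _ (H n))).
intros n; apply proj2_sig.
Qed.

Lemma large_choice U (HU : nonprincipal_ultrafilter U) (X : nat -> Type)
  (P : forall n, X n -> Prop) :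
  (forall n, exists x : X n, True) -> U (fun n => exists x, P n x) ->
  exists x : forall n, X n, U (fun n => P n (x n)).
Proof.
intros Hinh HP.
destruct (dependent_choice_function X
  (fun n x => (exists y, P n y) -> P n x)) as [x Hx].
- intros n; destruct (classic (exists y, P n y)) as [[y Hy]|Hn].
  + exists y; auto.
  + destruct (Hinh n) as [x _]; exists x; tauto.
- exists x; revert HP; apply large_mono; auto.
Qed.

(** Countable saturation of ultraproducts: in the [n]-th factor, an element is
    chosen that satisfies the strongest satisfiable condition among those with
    index at most [n].  A fixed condition is considered for almost all [n]
    because the ultrafilter contains the final segments. *)
Lemma realize_countable_type U (HU : nonprincipal_ultrafilter U)
  (X : nat -> Type) (C : nat -> forall n, X n -> Prop) :
  (forall n, exists x : X n, True) ->
  (forall m m' n x, m <= m' -> C m' n x -> C m n x) ->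
  (forall m, U (fun n => exists x, C m n x)) ->
  exists x : forall n, X n, forall m, U (fun n => C m n (x n)).
Proof.
intros Hinh Hdec HC.
assert (Hbest : forall n b, exists x, forall m, m <= b ->
  (exists y, C m n y) -> C m n x).
{ intros n; induction b as [|b [x Hx]].
  - destruct (classic (exists y, C 0 n y)) as [[y Hy]|Hn].
    + exists y; intros m Hm _; now replace m with 0 by lia.
    + destruct (Hinh n) as [x _]; exists x; intros m Hm H.
      replace m with 0 in H by lia; contradiction.
  - destruct (classic (exists y, C (S b) n y)) as [[y Hy]|Hn].
    + exists y; intros m Hm _; now apply (Hdec m (S b)).
    + exists x; intros m Hm H; destruct (Nat.eq_dec m (S b)) as [->|Hne].
      * contradiction.
      * apply Hx; auto; lia. }
destruct (dependent_choice_function X (fun n x => forall m, m <= n ->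
  (exists y, C m n y) -> C m n x)) as [x Hx].
- intros n; apply Hbest.
- exists x; intros m.
  apply (large_mono2 U HU (fun n => m <= n) (fun n => exists y, C m n y)); auto.
  now apply large_tail.
Qed.

(** * Ultraproducts of intuitionistic structures *)

(** No quotient is taken.  Individuals that agree almost everywhere may remain
    distinct, as the language has no equality.  The order of the worlds has to
    be antisymmetric, which is achieved by attaching to each world a counter
    that strictly increases along proper steps; satisfaction does not depend
    on the counter. *)
Definition up_world (M : nat -> structure) : Type :=
  ((forall n, world (M n)) * nat)%type.

Definition up_le (U : (nat -> Prop) -> Prop) (M : nat -> structure)
  (a b : up_world M) : Prop :=
  a = b \/ (U (fun n => wle (fst a n) (fst b n)) /\ snd a < snd b).

Lemma up_le_large U (HU : nonprincipal_ultrafilter U) M a b :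
  up_le U M a b -> U (fun n => wle (fst a n) (fst b n)).
Proof.
intros [<-|[H _]]; auto.
apply (large_all U HU); intros n.
destruct (wle_order (M n)) as [r _ _]; apply r.
Qed.

Lemma up_le_order U (HU : nonprincipal_ultrafilter U) M :
  order (up_world M) (up_le U M).
Proof.
split.
- intros a; now left.
- intros a b c [<-|[H1 H2]]; auto; intros [<-|[H3 H4]]; [right; auto|].
  right; split; [|lia].
  revert H1 H3; apply (large_mono2 U HU); intros n.
  destruct (wle_order (M n)) as [_ t _]; apply t.
- intros a b [<-|[H1 H2]]; auto; intros [<-|[H3 H4]]; auto; lia.
Qed.

Definition ultraproduct (U : (nat -> Prop) -> Prop)
  (HU : nonprincipal_ultrafilter U) (M : nat -> structure) : structure.
Proof.
refine (Structure (up_world M) (forall n, ind (M n)) (up_le U M)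
  (fun a d => U (fun n => dom (fst a n) (d n)))
  (fun a P d => U (fun n => ipred (fst a n) P (d n)))
  (fun a d e => U (fun n => irel (fst a n) (d n) (e n)))
  (up_le_order U HU M) _ _ _ _ _ _ _).
- intros a.
  destruct (dependent_choice_function (fun n => ind (M n))
    (fun n d => dom (fst a n) d)) as [d Hd].
  + intros n; apply dom_inhabited.
  + exists d; now apply (large_all U HU).
- intros d.
  destruct (dependent_choice_function (fun n => world (M n))
    (fun n w => dom w (d n))) as [w Hw].
  + intros n; apply dom_cover.
  + exists (w, 0); now apply (large_all U HU).
- intros a P d; apply large_mono; auto; intros n; apply ipred_dom.
- intros a d e H; split; revert H; apply large_mono; auto;
    intros n H; now apply (irel_dom (M n)) in H.
- intros a b d Hab; apply (large_mono2 U HU _ _ _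
    (fun n => dom_mono (M n) _ _ _) (up_le_large U HU M a b Hab)).
- intros a b P d Hab; apply (large_mono2 U HU _ _ _
    (fun n => ipred_mono (M n) _ _ _ _) (up_le_large U HU M a b Hab)).
- intros a b d e Hab; apply (large_mono2 U HU _ _ _
    (fun n => irel_mono (M n) _ _ _ _) (up_le_large U HU M a b Hab)).
Defined.

Lemma ind_inhabited (M : structure) (w : world M) : exists d : ind M, True.
Proof. destruct (dom_inhabited M w) as [d _]; eauto. Qed.

(** The theorem of Los.  In the steps for implication and universal
    quantification, a failure in almost all factors is turned into a failure
    in the ultraproduct by choosing counterexamples factor by factor; the
    world thus obtained is placed above the given one by raising the counter. *)
Lemma los U (HU : nonprincipal_ultrafilter U) (M : nat -> structure) f :
  forall (w : forall n, world (M n)) (k : nat)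
    (rho : assignment (ultraproduct U HU M)),
    sat (ultraproduct U HU M) (w, k) rho f <->
    U (fun n => sat (M n) (w n) (fun z => rho z n) f).
Proof.
assert (Hupd : forall (rho : assignment (ultraproduct U HU M)) x d g n v,
  sat (M n) v (fun z => update rho x d z n) g <->
  sat (M n) v (update (fun z => rho z n) x (d n)) g).
{ intros rho x d g n v; apply sat_free_ext; intros z _; unfold update.
  now destruct (Nat.eqb z x). }
induction f; intros w k rho; cbn [sat].
- reflexivity.
- reflexivity.
- split; [contradiction|].
  intros H; apply (proj1 (large_not U HU (fun _ => False))); auto.
  now apply (large_all U HU).
- rewrite IHf1, IHf2; split.
  + intros []; now apply (large_and U HU).
  + intros H; split; revert H; apply (large_mono U HU); tauto.
- rewrite IHf1, IHf2; symmetry; apply (large_or U HU).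
- split.
  + intros H; apply NNPP; intros Hn; apply (large_not U HU) in Hn.
    destruct (large_choice U HU (fun n => world (M n)) (fun n v =>
      wle (w n) v /\ sat (M n) v (fun z => rho z n) f1 /\
      ~ sat (M n) v (fun z => rho z n) f2)) as [v Hv].
    * intros n; exists (w n); auto.
    * revert Hn; apply (large_mono U HU); intros n Hn.
      apply not_all_ex_not in Hn; destruct Hn as [v Hv].
      exists v; tauto.
    * assert (Hf2 : U (fun n => sat (M n) (v n) (fun z => rho z n) f2)).
      { apply (IHf2 v (S k) rho), H.
        - right; split; [|simpl; lia].
          revert Hv; apply (large_mono U HU); tauto.
        - apply (IHf1 v (S k) rho); revert Hv; apply (large_mono U HU); tauto. }
      refine (proj1 (large_not U HU _) _ Hf2).
      revert Hv; apply (large_mono U HU); tauto.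
  + intros H [v l] Hv H1.
    apply (up_le_large U HU) in Hv; apply IHf1 in H1; apply IHf2.
    revert Hv; apply (large_mono2 U HU _ _ _ (fun n Hi Hle => Hi Hle)).
    revert H H1; apply (large_mono2 U HU); auto.
- split.
  + intros H; apply NNPP; intros Hn; apply (large_not U HU) in Hn.
    destruct (large_choice U HU (fun n => (world (M n) * ind (M n))%type)
      (fun n c => wle (w n) (fst c) /\ dom (fst c) (snd c) /\
      ~ sat (M n) (fst c) (update (fun z => rho z n) x (snd c)) f))
      as [c Hc].
    * intros n; destruct (ind_inhabited (M n) (w n)) as [d _].
      exists (w n, d); auto.
    * revert Hn; apply (large_mono U HU); intros n Hn.
      apply not_all_ex_not in Hn; destruct Hn as [v Hv].
      apply imply_to_and in Hv; destruct Hv as [Hv Hn].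
      apply not_all_ex_not in Hn; destruct Hn as [d Hd].
      exists (v, d); simpl; tauto.
    * assert (Hf : U (fun n => sat (M n) (fst (c n))
        (update (fun z => rho z n) x (snd (c n))) f)).
      { apply (large_mono U HU (fun n => sat (M n) (fst (c n))
          (fun z => update rho x (fun n => snd (c n)) z n) f)).
        - intros n; apply (Hupd rho x (fun n => snd (c n))).
        - apply (IHf (fun n => fst (c n)) (S k)), H.
          + right; split; [|simpl; lia].
            revert Hc; apply (large_mono U HU); tauto.
          + revert Hc; apply (large_mono U HU); tauto. }
      refine (proj1 (large_not U HU _) _ Hf).
      revert Hc; apply (large_mono U HU); tauto.
  + intros H [v l] Hv d Hd.
    apply (up_le_large U HU) in Hv; apply IHf.
    pose proof (large_and U HU _ _ Hv Hd) as Hvd.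
    revert H Hvd; apply (large_mono2 U HU); intros n H [Hn Hdn].
    apply Hupd, H; auto.
- split.
  + intros (d & Hd & H); apply IHf in H.
    revert Hd H; apply (large_mono2 U HU); intros n Hd H.
    exists (d n); split; auto; now apply Hupd.
  + intros H.
    apply (large_choice U HU (fun n => ind (M n))) in H.
    * destruct H as [d Hd]; exists d; split.
      -- revert Hd; apply (large_mono U HU); tauto.
      -- apply IHf; revert Hd; apply (large_mono U HU); intros n [_ H].
         now apply Hupd.
    * intros n; apply (ind_inhabited (M n) (w n)).
Qed.

(** Modal truth at an arbitrary pair of a world and an individual: the
    components of a point of an ultraproduct are points of the factors only
    for almost all indices. *)
Definition holds (M : structure) (w : world M) (d : ind M) (f : modal) : Prop :=
  sat M w (fun _ => d) (st 0 f).

Lemma force_ultraproduct U (HU : nonprincipal_ultrafilter U)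
  (M : nat -> structure) (p : point (ultraproduct U HU M)) f :
  force (B := induced (ultraproduct U HU M)) p f <->
  U (fun n => holds (M n) (fst (pt_world p) n) (pt_ind p n) f).
Proof.
rewrite <- (sat_st _ f 0 p (fun _ => pt_ind p) eq_refl).
destruct p as [[w k] d h]; apply los.
Qed.

Lemma large_agrees_on_stage U (HU : nonprincipal_ultrafilter U)
  (M : nat -> structure) (q : point (ultraproduct U HU M)) T m :
  agrees_on (B := induced (ultraproduct U HU M)) (stage m) T q ->
  U (fun n => forall f, List.In f (stage m) ->
       (holds (M n) (fst (pt_world q) n) (pt_ind q n) f <-> T f)).
Proof.
intros H; apply (large_all_in U HU); intros f Hf.
apply (large_iff_const U HU); rewrite <- force_ultraproduct; auto.
Qed.

Lemma force_of_large_agreement U (HU : nonprincipal_ultrafilter U)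
  (M : nat -> structure) (q : point (ultraproduct U HU M)) (T : modal -> Prop) :
  (forall m, U (fun n => forall f, List.In f (stage m) ->
     (holds (M n) (fst (pt_world q) n) (pt_ind q n) f <-> T f))) ->
  forall f, force (B := induced (ultraproduct U HU M)) q f <-> T f.
Proof.
intros H f; rewrite force_ultraproduct; apply (large_iff_const U HU).
destruct (stage_exhaustive f) as [m Hm].
generalize (H m); apply (large_mono U HU); auto.
Qed.

Lemma ultraproduct_saturated U (HU : nonprincipal_ultrafilter U)
  (M : nat -> structure) :
  saturated (induced (ultraproduct U HU M)).
Proof.
split; intros p T H.
- destruct p as [[w k] d h].
  destruct (realize_countable_type U HU (fun n => world (M n)) (fun m n v =>
    wle (w n) v /\
    forall f, List.In f (stage m) -> (holds (M n) v (d n) f <-> T f)))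
    as [v Hv].
  + intros n; exists (w n); auto.
  + intros m m' n v Hm [H1 H2]; split; auto; intros f Hf.
    apply H2; now apply (stage_mono m).
  + intros m; destruct (H m) as ([[v l] d' h'] & [Hle Hd] & Ha).
    simpl in Hd; subst d'.
    apply large_agrees_on_stage in Ha; apply (up_le_large U HU) in Hle.
    simpl in *; revert Hle Ha; apply (large_mono2 U HU); intros n Hle Ha.
    exists (v n); auto.
  + assert (Hle : up_le U M (w, k) (v, S k)).
    { right; split; [|simpl; lia].
      generalize (Hv 0); apply (large_mono U HU); tauto. }
    exists (Point (M := ultraproduct U HU M) (v, S k) d
      (dom_mono (ultraproduct U HU M) _ _ _ Hle h)).
    split; [split; auto|].
    apply force_of_large_agreement; simpl; intros m.
    generalize (Hv m); apply (large_mono U HU); tauto.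
- destruct p as [[w k] d h].
  destruct (realize_countable_type U HU
    (fun n => (world (M n) * ind (M n))%type) (fun m n c =>
    (wle (w n) (fst c) /\ irel (fst c) (d n) (snd c)) /\
    forall f, List.In f (stage m) ->
      (holds (M n) (fst c) (snd c) f <-> T f))) as [c Hc].
  + intros n; exists (w n, d n); auto.
  + intros m m' n v Hm [H1 H2]; split; auto; intros f Hf.
    apply H2; now apply (stage_mono m).
  + intros m.
    destruct (H m) as
      ([[v l] e he] & ([[v' l'] d' hd'] & [Hle Hd] & [Hw Hr]) & Ha).
    simpl in Hd, Hw; subst d'; injection Hw as -> ->.
    apply large_agrees_on_stage in Ha; apply (up_le_large U HU) in Hle.
    simpl in *; pose proof (large_and U HU _ _ Hle Hr) as Hlr.
    revert Hlr Ha; apply (large_mono2 U HU); intros n Hlr Ha.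
    exists (v n, e n); auto.
  + pose (v := fun n => fst (c n)); pose (e := fun n => snd (c n)).
    assert (Hle : up_le U M (w, k) (v, S k)).
    { right; split; [|simpl; lia].
      generalize (Hc 0); apply (large_mono U HU); tauto. }
    assert (Hr : @irel (ultraproduct U HU M) (v, S k) d e).
    { generalize (Hc 0); apply (large_mono U HU); tauto. }
    destruct (irel_dom _ _ _ _ Hr) as [Hd He].
    exists (Point (M := ultraproduct U HU M) (v, S k) e He); split.
    * exists (Point (M := ultraproduct U HU M) (v, S k) d Hd).
      split; split; auto.
    * apply force_of_large_agreement; simpl; intros m.
      generalize (Hc m); apply (large_mono U HU); tauto.
- destruct p as [[w k] d h].
  destruct (realize_countable_type U HU (fun n => ind (M n)) (fun m n e =>
    irel (w n) (d n) e /\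
    forall f, List.In f (stage m) -> T f -> holds (M n) (w n) e f))
    as [e He].
  + intros n; exists (d n); auto.
  + intros m m' n v Hm [H1 H2]; split; auto; intros f Hf.
    apply H2; now apply (stage_mono m).
  + intros m; destruct (H m) as ([[v l] e he] & [Hw Hr] & Ha).
    simpl in Hw; injection Hw as <- <-; simpl in Hr.
    assert (Hl : U (fun n => forall f, List.In f (stage m) ->
      T f -> holds (M n) (w n) (e n) f)).
    { apply (large_all_in U HU); intros f Hf.
      destruct (classic (T f)) as [HT|HT].
      - specialize (Ha f Hf HT); apply force_ultraproduct in Ha.
        simpl in Ha; revert Ha; apply (large_mono U HU); auto.
      - apply (large_all U HU); contradiction. }
    revert Hr Hl; apply (large_mono2 U HU); intros n Hr Hl.
    exists (e n); auto.
  + assert (Hr : @irel (ultraproduct U HU M) (w, k) d e).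
    { generalize (He 0); apply (large_mono U HU); tauto. }
    destruct (irel_dom _ _ _ _ Hr) as [_ Hde].
    exists (Point (M := ultraproduct U HU M) (w, k) e Hde); split.
    * split; auto.
    * intros f HT; apply force_ultraproduct; simpl.
      destruct (stage_exhaustive f) as [m Hm].
      generalize (He m); apply (large_mono U HU); intros n [_ Hn]; auto.
Qed.

(** * Ultraproducts of pointed structures and compactness *)

Definition pointed : Type := {M : structure & point M}.

Definition up_point U (HU : nonprincipal_ultrafilter U) (Q : nat -> pointed) :
  point (ultraproduct U HU (fun n => projT1 (Q n))) :=
  Point (M := ultraproduct U HU (fun n => projT1 (Q n)))
    (fun n => pt_world (projT2 (Q n)), 0) (fun n => pt_ind (projT2 (Q n)))
    (large_all U HU _ (fun n => pt_dom (projT2 (Q n)))).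

Lemma sat_up_point U (HU : nonprincipal_ultrafilter U) (Q : nat -> pointed) f :
  sat_pt (up_point U HU Q) f <-> U (fun n => sat_pt (projT2 (Q n)) f).
Proof. apply los. Qed.

Lemma force_up_point U (HU : nonprincipal_ultrafilter U) (Q : nat -> pointed)
  f :
  force (B := induced _) (up_point U HU Q) f <->
  U (fun n => force (B := induced _) (projT2 (Q n)) f).
Proof.
rewrite force_ultraproduct; split; apply (large_mono U HU); intros n;
  apply (sat_st _ f 0 (projT2 (Q n)) _ eq_refl).
Qed.

Definition modal_consequence (alpha : form) (f : modal) : Prop :=
  forall (M : structure) (p : point M),
    sat_pt p alpha -> force (B := induced M) p f.

(** Compactness: the [n]-th factor refutes [alpha] while forcing the modal
    consequences of [alpha] in [stage n].  It exists because their conjunction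
    follows from [alpha], but is not equivalent to it. *)
Lemma refuting_ultraproduct U (HU : nonprincipal_ultrafilter U) x alpha :
  only_free x alpha ->
  ~ (exists psi, logically_equivalent alpha (st x psi)) ->
  exists Q : nat -> pointed,
    ~ sat_pt (up_point U HU Q) alpha /\
    forall f, modal_consequence alpha f ->
      force (B := induced _) (up_point U HU Q) f.
Proof.
intros Ha Hne.
destruct (dependent_choice_function (fun _ => pointed) (fun n Q =>
  ~ sat_pt (projT2 Q) alpha /\ forall f, List.In f (stage n) ->
    modal_consequence alpha f -> force (B := induced _) (projT2 Q) f))
  as [Q HQ].
- intros n; apply NNPP; intros Hn; apply Hne.
  destruct (finite_conjunction (stage n) (modal_consequence alpha))
    as [theta Ht].
  exists theta; apply (logically_equivalent_st x alpha theta Ha).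
  intros M p; rewrite Ht; split.
  + intros Hp f _ Hf; now apply Hf.
  + intros Hp; apply NNPP; intros Hna; apply Hn.
    exists (existT _ M p); simpl; auto.
- exists Q; split.
  + rewrite sat_up_point; apply (large_not U HU).
    apply (large_all U HU); intros n; apply HQ.
  + intros f Hf; apply force_up_point.
    destruct (stage_exhaustive f) as [m Hm].
    apply (large_mono U HU (fun n => m <= n)); [|now apply large_tail].
    intros n Hn; apply HQ; auto; now apply (stage_mono m).
Qed.

(** If the part of the theory of [p] in [stage n] were realized at no point
    that satisfies [alpha], then the formula that excludes it would be a modal
    consequence of [alpha], because [alpha] is persistent.  That formula would
    then be forced at [p], which realizes this part itself. *)
Lemma satisfying_ultraproduct U (HU : nonprincipal_ultrafilter U) alpha
  (M : structure) (p : point M) :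
  (forall f, modal_consequence alpha f -> force (B := induced M) p f) ->
  exists Q : nat -> pointed,
    sat_pt (up_point U HU Q) alpha /\
    same_theory (B := induced _) (B' := induced M) (up_point U HU Q) p.
Proof.
intros Hp.
destruct (dependent_choice_function (fun _ => pointed) (fun n Q =>
  sat_pt (projT2 Q) alpha /\
  agrees_on (B := induced _) (stage n) (force (B := induced M) p) (projT2 Q)))
  as [Q HQ].
- intros n; apply NNPP; intros Hn.
  destruct (excluding_formula (stage n) (force (B := induced M) p))
    as [kappa Hk].
  apply (proj2 (excluding_formula_not_forced _ _ _ Hk (induced M) p)).
  + exists p; split; [apply ble_refl|intros f _; tauto].
  + apply Hp; intros N r Hr; apply Hk; intros q [Hw Hd] Hag.
    apply Hn; exists (existT _ N q); simpl; split; auto.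
    unfold sat_pt; rewrite <- Hd; eapply sat_persistent; eauto.
- exists Q; split.
  + apply sat_up_point, (large_all U HU); intros n; apply HQ.
  + intros f; rewrite force_up_point; apply (large_iff_const U HU).
    destruct (stage_exhaustive f) as [m Hm].
    apply (large_mono U HU (fun n => m <= n)); [|now apply large_tail].
    intros n Hn; apply HQ; now apply (stage_mono m).
Qed.

Lemma IK_invariant_sat_pt x alpha (M N : structure) (p : point M)
  (q : point N) Z :
  only_free x alpha -> IK_invariant x alpha ->
  IK_bisimulation (induced M) (induced N) Z -> Z p q ->
  (sat_pt p alpha <-> sat_pt q alpha).
Proof.
intros Ha Hinv HZ; destruct p as [w d h], q as [v e h']; intros Hpq.
rewrite <- !(sat_at_sat_pt _ _ x) by auto.
now apply (Hinv M N w v d e h h' Z).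
Qed.

Theorem theorem7p2 (x : var) (alpha : form) (Halpha : only_free x alpha) :
  (exists psi : modal, logically_equivalent alpha (st x psi)) <->
  IK_invariant x alpha.
Proof.
split.
- intros [psi Hpsi] M N w v d e h h' Z HZ Hpq.
  pose proof (proj1 (logically_equivalent_st x alpha psi Halpha) Hpsi) as Heq.
  rewrite (sat_at_sat_pt M w x d h), (sat_at_sat_pt N v x e h') by auto.
  rewrite !Heq; now apply (bisimulation_force _ _ Z HZ).
- intros Hinv; apply NNPP; intros Hne.
  destruct nonprincipal_ultrafilter_exists as [U HU].
  destruct (refuting_ultraproduct U HU x alpha Halpha Hne) as (P & HnP & HP).
  destruct (satisfying_ultraproduct U HU alpha _ _ HP) as (Q & HQ & Hsame).
  apply HnP; refine (proj1 (IK_invariant_sat_pt x alpha _ _ _ _ same_theory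
    Halpha Hinv _ Hsame) HQ).
  apply hennessy_milner; apply ultraproduct_saturated.
Qed.
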